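(* Let $A\in\mathbb{R}^{n,n}$, $B\in\mathbb{R}^{n,m}$ and $C\in\mathbb{R}^{p,n}$. Then $(A,B,C)$ is stabilizable, i.e. $\mathcal K(A,B,C)\neq\emptyset$, if and only if there exists $(J,R,Q)\in\mathbb{D}\mathbb{H}_{\succ}^n$ such that $$(I_n-BB^{\dagger})(A-(J-R)Q)=0\quad\text{and}\quad (A-(J-R)Q)(C^{\dagger}C-I_n)=0. \qquad ( * )$$ Moreover, for every $(J,R,Q)\in\mathbb{D}\mathbb{H}_{\succ}^n$ satisfying $( * )$, $$\widetilde{\mathcal K}(J,R,Q)=\Big\{\, f(J,R,Q)+(I_m-B^{\dagger}B)Y+Z(I_p-CC^{\dagger}) \;\Big|\; Y,Z\in\mathbb{R}^{m,p}\Big\}.$$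
   Context: $\mathbb{R}^{n,m}$ denotes the set of real $n\times m$ matrices. $X^T$ is the transpose and $X^{\dagger}$ the Moore-Penrose pseudoinverse of $X$; $I_n$ is the $n\times n$ identity. $X\succ0$ (resp. $X\succeq 0$) means $X$ is symmetric positive definite (resp. symmetric positive semidefinite). A real square matrix is called stable if all its eigenvalues have real part $\le 0$ and every eigenvalue on the imaginary axis is semisimple. $\mathcal K(A,B,C):=\{K\in\mathbb{R}^{m,p} \mid A-BKC \text{ is stable}\}$. The set $\mathbb{D}\mathbb{H}_{\succ}^n:=\{(J,R,Q)\in(\mathbb{R}^{n,n})^3 \mid J^T=-J,\ R\succeq 0,\ Q\succ 0\}$. For $(J,R,Q)\in(\mathbb{R}^{n,n})^3$, $f(J,R,Q):=B^{\dagger}(A-(J-R)Q)C^{\dagger}$. For $(J,R,Q)\in\mathbb{D}\mathbb{H}_{\succ}^n$, $\widetilde{\mathcal K}(J,R,Q):=\{K\in\mathcal K(A,B,C) \mid K=f(J,R,Q)+Z-B^{\dagger}BZCC^{\dagger} \text{ for some } Z\in\mathbb{R}^{m,p}\}$. *)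

(* Defs.v *)
From HB Require Import structures.
From mathcomp Require Import all_boot all_order all_algebra.
From mathcomp Require Import boolp classical_sets reals.
From mathcomp Require Import complex.

Set Implicit Arguments.
Unset Strict Implicit.
Unset Printing Implicit Defensive.

Import Order.TTheory GRing.Theory Num.Theory.

Local Open Scope classical_set_scope.
Local Open Scope ring_scope.

Definition penrose (F : realType) (m n : nat) (X : 'M[F]_(m, n))
    (Y : 'M[F]_(n, m)) : Prop :=
  [/\ X *m Y *m X = X, Y *m X *m Y = Y,
      (X *m Y)^T = X *m Y & (Y *m X)^T = Y *m X].

(* Not to be confused with MathComp's [pinvmx], which is only a partial inverse
   on the row space.  The default value 0 is never used: see [mppinvP]. *)
Definition mppinv (F : realType) (m n : nat) (X : 'M[F]_(m, n)) :
    'M[F]_(n, m) :=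
  xget 0 [set Y | penrose X Y].

Lemma penrose_unique (F : realType) (m n : nat) (X : 'M[F]_(m, n))
  (Y Z : 'M[F]_(n, m)) : penrose X Y -> penrose X Z -> Y = Z.
Proof.
move=> [y1 y2 y3 y4] [z1 z2 z3 z4].
have eY : Y *m X = Z *m X.
  have e : Y *m X = (Y *m X) *m (Z *m X) by rewrite -mulmxA (mulmxA X) z1.
  by rewrite -y4 e trmx_mul y4 z4 -mulmxA (mulmxA X) y1.
have eX : X *m Y = X *m Z.
  have e : X *m Y = (X *m Z) *m (X *m Y) by rewrite mulmxA z1.
  by rewrite -y3 e trmx_mul y3 z3 mulmxA y1.
by rewrite -y2 eY -mulmxA eX mulmxA z2.
Qed.

Lemma gram_unitmx (F : realType) (m n : nat) (M : 'M[F]_(m, n)) :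
  row_free M -> M *m M^T \in unitmx.
Proof.
move=> freeM; rewrite -row_free_unit -kermx_eq0; apply/eqP/row_matrixP => i.
rewrite row0; set v := row i _.
have v0 : v *m (M *m M^T) = 0.
  by rewrite /v -row_mul mulmx_ker row0.
apply: (row_free_inj freeM); rewrite mul0mx; apply/rowP => j.
have : (v *m M *m (v *m M)^T) 0 0 = 0.
  by rewrite trmx_mul -mulmxA (mulmxA M) mulmxA v0 mul0mx mxE.
rewrite mxE => /eqP; rewrite psumr_eq0 => [/allP/(_ j)|k _]; last first.
  by rewrite [(_^T) _ _]mxE -expr2 sqr_ge0.
rewrite mem_index_enum => /(_ isT) /=.
by rewrite [(_^T) _ _]mxE mulf_eq0 orbb => /eqP->; rewrite mxE.
Qed.

Lemma mppinvP (F : realType) (m n : nat) (X : 'M[F]_(m, n)) :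
  penrose X (mppinv X).
Proof.
suff [Y PY] : exists Y, penrose X Y 
  by apply: (@xgetPex _ 0 [set Y | penrose X Y]); exists Y.
have : exists r (C : 'M[F]_(m, r)) (R : 'M[F]_(r, n)),
    [/\ X = C *m R, row_full C & row_free R].
  exists (\rank X), (col_base X), (row_base X).
  by rewrite mulmx_base row_base_free col_base_full.
move=> [r [C [R [XE fullC freeR]]]].
have uR : R *m R^T \in unitmx by exact: gram_unitmx.
have uC : C^T *m C \in unitmx.
  by rewrite -{2}(trmxK C); apply: gram_unitmx; rewrite /row_free mxrank_tr.
set S := invmx (R *m R^T); set T := invmx (C^T *m C).
have ST : S^T = S by rewrite /S trmx_inv trmx_mul trmxK.
have TT : T^T = T by rewrite /T trmx_inv trmx_mul trmxK.
exists (R^T *m S *m T *m C^T).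
have e1 : X *m (R^T *m S *m T *m C^T) = C *m T *m C^T.
  by rewrite XE !mulmxA -(mulmxA C R) -(mulmxA C (R *m _)) (mulmxV uR) mulmx1.
have e2 : R^T *m S *m T *m C^T *m X = R^T *m S *m R.
  by rewrite XE !mulmxA -(mulmxA _ C^T) -(mulmxA _ T) (mulVmx uC) mulmx1.
split.
- by rewrite e1 XE !mulmxA -(mulmxA _ C^T) -(mulmxA C) (mulVmx uC) mulmx1.
- rewrite e2 !mulmxA -(mulmxA _ R) -(mulmxA _ (R *m _)) (mulmxV uR).
  by rewrite mulmx1.
- by rewrite e1 !trmx_mul trmxK TT mulmxA.
- by rewrite e2 !trmx_mul trmxK ST mulmxA.
Qed.

Definition possemidef (F : realType) (n : nat) (X : 'M[F]_n) : Prop :=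
  X^T = X /\ forall x : 'cV[F]_n, 0 <= (x^T *m X *m x) 0 0.

Definition posdef (F : realType) (n : nat) (X : 'M[F]_n) : Prop :=
  X^T = X /\ forall x : 'cV[F]_n, x != 0 -> 0 < (x^T *m X *m x) 0 0.

(* Geometric multiplicity = algebraic multiplicity.  MathComp's eigenspaces
   consist of row vectors; they have the same dimensions as the usual ones. *)
Definition semisimple_eigenvalue (L : fieldType) (n : nat) (M : 'M[L]_n)
    (a : L) : Prop :=
  eigenvalue M a /\ \rank (eigenspace M a) = mup a (char_poly M).

Definition stable (F : realType) (n : nat) (M : 'M[F]_n) : Prop :=
  let MC : 'M[F[i]%C]_n := map_mx (real_complex F) M in
  forall a : F[i]%C, eigenvalue MC a ->
    complex.Re a <= 0 /\ (complex.Re a = 0 -> semisimple_eigenvalue MC a).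

Definition stabilizing_gains (F : realType) (n m p : nat) (A : 'M[F]_n)
    (B : 'M[F]_(n, m)) (C : 'M[F]_(p, n)) : set 'M[F]_(m, p) :=
  [set K | stable (A - B *m K *m C)].

Definition stabilizable (F : realType) (n m p : nat) (A : 'M[F]_n)
    (B : 'M[F]_(n, m)) (C : 'M[F]_(p, n)) : Prop :=
  stabilizing_gains A B C !=set0.

Definition DHpos (F : realType) (n : nat) (J R Q : 'M[F]_n) : Prop :=
  [/\ J^T = - J, possemidef R & posdef Q].

Definition DH_gain (F : realType) (n m p : nat) (A : 'M[F]_n)
    (B : 'M[F]_(n, m)) (C : 'M[F]_(p, n)) (J R Q : 'M[F]_n) : 'M[F]_(m, p) :=
  mppinv B *m (A - (J - R) *m Q) *m mppinv C.

Definition DH_stabilizing_gains (F : realType) (n m p : nat) (A : 'M[F]_n)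
    (B : 'M[F]_(n, m)) (C : 'M[F]_(p, n)) (J R Q : 'M[F]_n) :
    set 'M[F]_(m, p) :=
  [set K | stabilizing_gains A B C K /\ exists Z : 'M[F]_(m, p),
    K = DH_gain A B C J R Q + Z - mppinv B *m B *m Z *m C *m mppinv C].

Definition DH_compatible (F : realType) (n m p : nat) (A : 'M[F]_n)
    (B : 'M[F]_(n, m)) (C : 'M[F]_(p, n)) (J R Q : 'M[F]_n) : Prop :=
  (1%:M - B *m mppinv B) *m (A - (J - R) *m Q) = 0 /\
  (A - (J - R) *m Q) *m (mppinv C *m C - 1%:M) = 0.

(* Main.v *)
Require Import Defs.
From HB Require Import structures.
From mathcomp Require Import all_boot all_order all_algebra.
From mathcomp Require Import boolp classical_sets reals.
From mathcomp Require Import complex.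
From mathcomp Require Import ring.

Set Implicit Arguments.
Unset Strict Implicit.
Unset Printing Implicit Defensive.

Import Order.TTheory GRing.Theory Num.Theory.

Local Open Scope classical_set_scope.
Local Open Scope ring_scope.
Local Open Scope sesquilinear_scope.

(* The key fact is that a real matrix M is stable iff M = (J - R) Q with J skew,
   R positive semidefinite and Q positive definite.
   If M is stable, split off the eigenspaces of the imaginary eigenvalues
   one at a time (semisimplicity makes ker (M - b) a complement of the image);
   what remains is Hurwitz, hence dissipative after a Schur triangularization and
   a diagonal scaling.  Pulling back gives a complex Hermitian H > 0 with
   Re (x^* H M x) <= 0, and Q := Re H is a real Lyapunov matrix; J and -R are the
   skew and symmetric parts of M Q^-1.
   Conversely, for a row eigenvector v M = b v, pairing v (J - R) = b v Q^-1 with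
   v^* gives Re b <= 0, and when Re b = 0 it gives v R = 0, which rules out a
   Jordan chain of length two.
   The theorem follows since (A - (J - R) Q) = B K C is solvable in K exactly when
   the two projection equations hold, f(J, R, Q) being then a solution. *)

(** * Characteristic polynomials and semisimplicity as a kernel condition *)

(** [P] is invertible, so this is similarity invariance, proved by cancelling the determinant of [P]
    over polynomials. The rectangular type allows [P] to stack bases of a subspace and of a
    complement, whose row count equals [n] only propositionally. *)
Lemma char_poly_intertwine (L : fieldType) (k n : nat) (P : 'M[L]_(k, n))
    (M : 'M[L]_n) (S : 'M[L]_k) :
  row_free P -> row_full P -> P *m M = S *m P -> char_poly M = char_poly S.
Proof.
move=> freeP fullP; have kn : k = n by rewrite -(eqP freeP) (eqP fullP).
case: _ / kn in P M freeP fullP * => PM.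
have detP : \det (map_mx polyC P) != 0.
  by rewrite det_map_mx polyC_eq0 -unitfE -unitmxE -row_free_unit.
apply: (mulfI detP); rewrite [RHS]mulrC -!det_mulmx; congr (\det _).
rewrite mulmxBr mulmxBl -!map_mxM PM; congr (_ - _).
by rewrite scalar_mxC.
Qed.

(** In a basis adapted to [W] and a complement, [M] is block lower triangular; [S] is its
    restriction to [W] and [U] its action on the quotient. The last clause lifts an eigenvector of
    the quotient. *)
Lemma char_poly_stable (L : fieldType) (m n : nat) (W : 'M[L]_(m, n))
    (M : 'M[L]_n) :
  stablemx W M -> exists (S : 'M_(\rank W)) (U : 'M_(\rank W^C)),
    [/\ char_poly M = char_poly S * char_poly U,
        row_base W *m M = S *m row_base W &
        forall b, eigenvalue U b -> exists v : 'rV[L]_n,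
          ~~ (v <= W)%MS /\ (v *m (M - b%:M) <= W)%MS].
Proof.
move=> stW; pose V := row_base W^C%MS; pose P := col_mx (row_base W) V.
have rP : \rank P = n.
  rewrite -addsmxE (adds_eqmx (eq_row_base W) (eq_row_base _)).
  by have /eqP := addsmx_compl_full W.
have sz : (\rank W + \rank W^C = n)%N.
  by rewrite mxrank_compl subnKC // rank_leq_col.
have freeP : row_free P by rewrite /row_free rP sz.
have fullP : row_full P by rewrite /row_full rP.
have [S SE] : exists S, row_base W *m M = S *m row_base W.
  apply/submxP; rewrite eq_row_base.
  by apply: submx_trans stW; rewrite submxMr // eq_row_base.
have [D DE] : exists D, V *m M = D *m P.
  by apply/submxP; apply: submx_full.
pose T := lsubmx D; pose U := rsubmx D.
have VE : V *m M = T *m row_base W + U *m V.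
  by rewrite DE -{1}(hsubmxK D) mul_row_col.
exists S, U; split=> //.
  rewrite (@char_poly_intertwine _ _ _ P M (block_mx S 0 T U)) //; last first.
    by rewrite mul_col_mx mul_block_col mul0mx addr0 SE VE.
  rewrite /char_poly /char_poly_mx map_block_mx map_mx0 scalar_mx_block.
  by rewrite opp_block_mx add_block_mx oppr0 !addr0 det_lblock.
move=> b /eigenvalueP[v vU v0]; exists (v *m V); split; last first.
  rewrite mulmxBr -mulmxA VE mulmxDr (mulmxA v U) (mulmxA v T) vU.
  rewrite mul_mx_scalar -scalemxAl addrK.
  by rewrite -(eq_row_base W) submxMl.
(* A lift lying in [W] would be a linear relation between the rows of the two bases, which are
   independent. *)
apply/negP => vW; move/negP: v0; apply.
have /submxP[w wE] : (v *m V <= row_base W)%MS by rewrite eq_row_base.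
have /(row_free_inj freeP) : row_mx (- w) v *m P = 0 *m P.
  by rewrite mul_row_col mulNmx -wE addNr mul0mx.
by move/(congr1 rsubmx); rewrite row_mxKr linear0 => ->.
Qed.

(** Each eigenvalue b satisfies (b - a)^2 = 0, so all roots equal [a], and the degree gives their
    number. *)
Lemma char_poly_sqr_nilpotent (L : closedFieldType) (n : nat) (S : 'M[L]_n) a :
  (S - a%:M) *m (S - a%:M) = 0 -> char_poly S = ('X - a%:P) ^+ n.
Proof.
move=> N2; have [r rE] := closed_field_poly_normal (char_poly S).
move: rE; rewrite (monicP (char_poly_monic S)) scale1r => rE.
have ra : all (pred1 a) r.
  apply/allP => b br /=.
  have : eigenvalue S b by rewrite eigenvalue_root_char rE root_prod_XsubC.
  case/eigenvalueP => v vS v0.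
  have vN : v *m (S - a%:M) = (b - a) *: v.
    by rewrite mulmxBr vS mul_mx_scalar scalerBl.
  have /eqP : v *m ((S - a%:M) *m (S - a%:M)) = 0 by rewrite N2 mulmx0.
  rewrite mulmxA vN -scalemxAl vN scalerA scaler_eq0 (negbTE v0) orbF.
  by rewrite mulf_eq0 orbb subr_eq0.
have sr : size r = n.
  by have := size_char_poly S; rewrite rE size_prod_XsubC => -[].
move: rE; rewrite (all_pred1P _ _ ra) big_nseq sr => ->.
by rewrite -Monoid.iteropE.
Qed.

(** Both sides say that ker N^2 = ker N, i.e. that [a] has no Jordan chain of length two. From left
    to right, the dimension of ker N^2 is at most the algebraic multiplicity. From right to left,
    [a] is not an eigenvalue on the quotient by the eigenspace, since a lifted eigenvector would lie
    in ker N^2 but not in ker N. *)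
Lemma geometric_mup_eqP (L : closedFieldType) (n : nat) (M : 'M[L]_n) a :
  \rank (eigenspace M a) = mup a (char_poly M) <->
  forall v : 'rV[L]_n, v *m (M - a%:M) *m (M - a%:M) = 0 -> v *m (M - a%:M) = 0.
Proof.
set N := M - a%:M.
have NM : M *m N = N *m M by rewrite mulmxBl mulmxBr scalar_mxC.
have sqr k (W : 'M_(k, n)) S : W *m N *m N = 0 ->
    row_base W *m M = S *m row_base W -> char_poly S = ('X - a%:P) ^+ \rank W.
  move=> WN SE; apply: char_poly_sqr_nilpotent.
  apply: (row_free_inj (row_base_free W)).
  have E : (S - a%:M) *m row_base W = row_base W *m N.
    by rewrite mulmxBl mulmxBr SE scalar_mxC.
  rewrite mul0mx -mulmxA E mulmxA E.
  have /submxP[D ->] : (row_base W <= W)%MS by rewrite eq_row_base.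
  by rewrite -!mulmxA (mulmxA W) WN mulmx0.
have cp0 k (S : 'M[L]_k) : char_poly S != 0.
  by rewrite monic_neq0 // char_poly_monic.
(* An invariant subspace killed by N^2 contributes its full dimension to the multiplicity. This is
   used with W = ker N^2, then with W = ker N. *)
have mupE k (W : 'M_(k, n)) S j (U : 'M_j) : W *m N *m N = 0 ->
    char_poly M = char_poly S * char_poly U ->
    row_base W *m M = S *m row_base W ->
    mup a (char_poly M) = (\rank W + mup a (char_poly U))%N.
  move=> WN -> /(sqr _ _ _ WN) SE.
  by rewrite mupM // SE mup_XsubCX eqxx.
split=> [rk v vNN | ker2].
  pose K := kermx (N *m N).
  have KNN : K *m N *m N = 0 by rewrite -mulmxA mulmx_ker.
  have stK : stablemx K M.
    apply/sub_kermxP; rewrite -mulmxA.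
    have -> : M *m (N *m N) = N *m N *m M by rewrite mulmxA NM -mulmxA NM mulmxA.
    by rewrite mulmxA mulmx_ker mul0mx.
  have [S [U [cpM SE _]]] := char_poly_stable stK.
  have EK : (eigenspace M a <= K)%MS.
    by apply/sub_kermxP; rewrite mulmxA mulmx_ker mul0mx.
  have /eqmxP KE : (eigenspace M a == K)%MS.
    rewrite -mxrank_leqif_eq // eqn_leq mxrankS //= rk.
    rewrite (mupE _ _ _ _ _ KNN cpM SE).
    exact: leq_addr.
  apply/sub_kermxP; change (v <= eigenspace M a)%MS; rewrite KE.
  by apply/sub_kermxP; rewrite mulmxA.
have EN : eigenspace M a *m N = 0 by rewrite mulmx_ker.
have stE : stablemx (eigenspace M a) M.
  by apply/sub_kermxP; rewrite -mulmxA NM mulmxA EN mul0mx.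
have [S [U [cpM SE UE]]] := char_poly_stable stE.
rewrite (mupE _ _ _ _ _ _ cpM SE) ?EN ?mul0mx // mupNroot ?addn0 //.
rewrite -eigenvalue_root_char; apply/negP => /UE[v [vE vN]].
case/negP: vE; apply/sub_kermxP; apply: ker2.
exact/sub_kermxP.
Qed.

(* Kernel form of semisimplicity on the imaginary axis: unlike the multiplicity
   form, it passes directly to restrictions. *)
Definition semistable (C : numClosedFieldType) (n : nat) (M : 'M[C]_n) : Prop :=
  forall b, eigenvalue M b -> 'Re b <= 0 /\
    ('Re b = 0 -> forall v : 'rV[C]_n,
       v *m (M - b%:M) *m (M - b%:M) = 0 -> v *m (M - b%:M) = 0).

(** * Lyapunov matrices over the complex numbers *)

(** [H] is only semidefinite here: a pullback along a non-injective map loses definiteness, which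
    can be regained by adding pullbacks. Hence [definite] is a separate predicate. *)
Definition lyapunov (C : numClosedFieldType) (n : nat) (H M : 'M[C]_n) : Prop :=
  [/\ H^t* = H, forall x : 'cV[C]_n, 0 <= (x^t* *m H *m x) 0 0 &
      forall x : 'cV[C]_n, 'Re ((x^t* *m H *m M *m x) 0 0) <= 0].

Definition definite (C : numClosedFieldType) (n : nat) (H : 'M[C]_n) : Prop :=
  forall x : 'cV[C]_n, (x^t* *m H *m x) 0 0 = 0 -> x = 0.

Lemma trmxC_mul (C : numClosedFieldType) (m n p : nat) (X : 'M[C]_(m, n))
  (Y : 'M[C]_(n, p)) : (X *m Y)^t* = Y^t* *m X^t*.
Proof. by rewrite trmx_mul map_mxM. Qed.

Lemma cnormE (C : numClosedFieldType) (n : nat) (x : 'cV[C]_n) :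
  (x^t* *m x) 0 0 = \sum_i `|x i 0| ^+ 2.
Proof. by rewrite mxE; apply: eq_bigr => i _; rewrite !mxE mulrC -normCK. Qed.

Lemma cnorm_ge0 (C : numClosedFieldType) (n : nat) (x : 'cV[C]_n) :
  0 <= (x^t* *m x) 0 0.
Proof. by rewrite cnormE sumr_ge0 // => i _; rewrite exprn_ge0. Qed.

Lemma cnorm_eq0 (C : numClosedFieldType) (n : nat) (x : 'cV[C]_n) :
  (x^t* *m x) 0 0 = 0 -> x = 0.
Proof.
rewrite cnormE => /psumr_eq0P x0; apply/colP => i; rewrite mxE.
by apply/eqP; rewrite -normr_eq0 -sqrf_eq0 x0 // => j _; rewrite exprn_ge0.
Qed.

Lemma lyapunov1 (C : numClosedFieldType) (n : nat) (M : 'M[C]_n) :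
  (forall x : 'cV[C]_n, 'Re ((x^t* *m M *m x) 0 0) <= 0) -> lyapunov 1%:M M.
Proof.
move=> Mle; split=> [|x|x]; rewrite ?mulmx1 ?cnorm_ge0 //.
by rewrite trmx1 map_mx1.
Qed.

Lemma form_pullback (C : numClosedFieldType) (k n : nat) (P : 'M[C]_(k, n))
    (H : 'M[C]_k) (x : 'cV[C]_n) :
  x^t* *m (P^t* *m H *m P) *m x = (P *m x)^t* *m H *m (P *m x).
Proof. by rewrite trmxC_mul !mulmxA. Qed.

Lemma lyapunov_pullback (C : numClosedFieldType) (k n : nat) (P : 'M[C]_(k, n))
    (H S : 'M[C]_k) (M : 'M[C]_n) :
  P *m M = S *m P -> lyapunov H S -> lyapunov (P^t* *m H *m P) M.
Proof.
move=> PM [HH Hge Hle]; split=> [|x|x].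
- by rewrite !trmxC_mul trmxCK HH mulmxA.
- by rewrite form_pullback.
by have := Hle (P *m x); rewrite trmxC_mul !mulmxA -(mulmxA _ S) -PM !mulmxA.
Qed.

Lemma lyapunovD (C : numClosedFieldType) (n : nat) (G H M : 'M[C]_n) :
  lyapunov G M -> lyapunov H M -> lyapunov (G + H) M.
Proof.
move=> [GG Gge Gle] [HH Hge Hle]; split=> [|x|x].
- by rewrite linearD map_mxD GG HH.
- by rewrite mulmxDr mulmxDl mxE addr_ge0.
rewrite mulmxDr !mulmxDl mxE raddfD.
by have := lerD (Gle x) (Hle x); rewrite addr0.
Qed.

(** Right multiplication by [P] is injective and carries eigenvectors and Jordan chains of [S] to
    those of [M]. *)
Lemma semistable_restrict (C : numClosedFieldType) (k n : nat)
    (P : 'M[C]_(k, n)) (S : 'M[C]_k) (M : 'M[C]_n) :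
  row_free P -> P *m M = S *m P -> semistable M -> semistable S.
Proof.
move=> freeP PM stM b /eigenvalueP[v vS v0].
have PN : P *m (M - b%:M) = (S - b%:M) *m P.
  by rewrite mulmxBl mulmxBr PM scalar_mxC.
have : eigenvalue M b.
  apply/eigenvalueP; exists (v *m P).
    by rewrite -mulmxA PM mulmxA vS scalemxAl.
  by rewrite mulmx_free_eq0.
case/stM => Reb semib; split=> // /semib {}semib w wNN.
apply: (row_free_inj freeP); rewrite mul0mx -mulmxA -PN mulmxA; apply: semib.
by rewrite -(mulmxA w) PN mulmxA -mulmxA PN mulmxA wNN mul0mx.
Qed.

(** The inequality 2 |x_i| |x_j| <= |x_i|^2 + |x_j|^2 bounds the off-diagonal terms by a total that
    the diagonal compensates. *)
Lemma diag_dominant_dissipative (C : numClosedFieldType) (n : nat)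
    (S : 'M[C]_n) (e : C) :
  0 <= e -> (forall i, 'Re (S i i) <= - (n%:R * e)) ->
  (forall i j, i != j -> `|S i j| <= e) ->
  forall x : 'cV[C]_n, 'Re ((x^t* *m S *m x) 0 0) <= 0.
Proof.
move=> e0 Sd So x; pose q i := `|x i 0| ^+ 2.
have q0 i : 0 <= q i by rewrite exprn_ge0.
rewrite -mulmxA mxE raddf_sum.
(* The diagonal terms are given the same slack e (q_i + q_j) / 2 as the others, so that the double
   sum has a closed form. *)
have term i j : 'Re ((x i 0)^* * S i j * x j 0) <=
    (if j == i then - (n%:R * e) * q i else 0) + e * (q i + q j) / 2.
  have [->|ij] := eqVneq j i.
    rewrite -mulrA [S i i * _]mulrC mulrA [_^* * _]mulrC -normCK.
    rewrite -/(q i) ReMl ?ger0_real // [q i * _]mulrC.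
    apply: (@le_trans _ _ (- (n%:R * e) * q i)); first by rewrite ler_wpM2r.
    by rewrite lerDl divr_ge0 ?ler0n // mulr_ge0 // addr_ge0.
  rewrite add0r; apply: (le_trans (leif_Re_Creal _)).
  rewrite !normrM norm_conjC mulrAC mulrC -mulrA.
  rewrite ler_pM ?mulr_ge0 ?So // 1?eq_sym //.
  rewrite ler_pdivlMr ?ltr0n // -subr_ge0.
  have -> : q i + q j - `|x i 0| * `|x j 0| * 2%:R =
      (`|x i 0| - `|x j 0|) ^+ 2.
    by rewrite /q; ring.
  by rewrite real_exprn_even_ge0 // rpredB ?normr_real.
apply: (@le_trans _ _ (\sum_i \sum_j
    ((if j == i then - (n%:R * e) * q i else 0) + e * (q i + q j) / 2))).
  apply: ler_sum => i _; rewrite [(S *m x) i 0]mxE mulr_sumr raddf_sum.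
  rewrite ler_sum // => j _.
  by rewrite !mxE mulrA term.
pose Q := \sum_i q i.
have E1 : \sum_i \sum_j (if j == i then - (n%:R * e) * q i else 0)
    = - (n%:R * e) * Q.
  rewrite /Q mulr_sumr; apply: eq_bigr => i _.
  by rewrite -big_mkcond /= big_pred1_eq.
have E2 : \sum_i \sum_j (q i + q j) = n%:R * Q + n%:R * Q.
  under eq_bigr do rewrite big_split /= sumr_const card_ord -mulr_natl.
  by rewrite big_split /= sumr_const card_ord -mulr_sumr -(mulr_natl Q).
under eq_bigr do rewrite big_split /= -mulr_suml -mulr_sumr.
rewrite big_split /= E1 -mulr_suml -mulr_sumr E2.
(* The bound is exactly zero: - n e Q + e (2 n Q) / 2. *)
set m := n%:R; rewrite le_eqVlt; apply/orP; left; apply/eqP.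
by clearbody Q m; field.
Qed.

Lemma hurwitz_lyapunov (C : numClosedFieldType) (n : nat) (M : 'M[C]_n) :
  (forall b, eigenvalue M b -> 'Re b < 0) ->
  exists H, lyapunov H M /\ definite H.
Proof.
(* Size zero is treated apart because [Schur] requires a positive size. *)
case: n M => [|n] M ReM.
  exists 1%:M; split; last by move=> x _; apply/colP; case.
  apply: lyapunov1 => x; rewrite (_ : x = 0) ?mulmx0 ?mxE ?raddf0 //.
  by apply/colP; case.
have [P Pu simP] := Schur M isT.
have trT : is_trig_mx (conjmx P M) := simP.
rewrite conjymx // in trT.
set T := P *m M *m P^t* in trT.
have PM : P *m M = T *m P.
  by rewrite /T -[RHS]mulmxA -(invmx_unitary Pu) mulVmx ?mulmx1 ?unitarymx_unit.
have Punit := unitarymx_unit Pu.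
have diagT i : 'Re (T i i) < 0.
  apply: ReM; rewrite eigenvalue_root_char.
  rewrite (@char_poly_intertwine _ _ _ P M T) ?row_free_unit ?row_full_unit //.
  by rewrite char_poly_trig // (bigD1 i) //= rootM root_XsubC eqxx.
(* With d_i = - Re T_ii, conjugation by diag(t^i) multiplies T_ij (j < i) by
   t^(i-j) <= t; here e = t K and (n+1) e = 1/s <= d_i. *)
pose s : C := 1 + \sum_i (- 'Re (T i i))^-1.
pose K : C := 1 + \sum_i \sum_j `|T i j|.
have s1 : 1 <= s.
  by rewrite lerDl sumr_ge0 // => j _; rewrite invr_ge0 oppr_ge0 ltW.
have K1 : 1 <= K.
  by rewrite lerDl sumr_ge0 // => i _; rewrite sumr_ge0.
have s0 : 0 < s := lt_le_trans ltr01 s1.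
have K0 : 0 < K := lt_le_trans ltr01 K1.
pose e := (s * n.+1%:R)^-1.
have e0 : 0 < e by rewrite invr_gt0 mulr_gt0 ?ltr0n.
have e1 : e <= 1.
  by rewrite invf_le1 ?mulr_gt0 ?ltr0n // mulr_ege1 ?ler1n.
pose t := e / K.
have t0 : 0 < t by rewrite divr_gt0.
have t1 : t <= 1.
  by rewrite ler_pdivrMr // mul1r (le_trans e1).
pose D := diag_mx (\row_(i < n.+1) t ^+ i).
pose E := diag_mx (\row_(i < n.+1) t ^- i).
have ED : E *m D = 1%:M.
  rewrite mulmx_diag -diag_const_mx; congr diag_mx; apply/rowP => i.
  by rewrite !mxE mulVf // expf_neq0 // gt_eqF.
have DE : D *m E = 1%:M by apply: mulmx1C.
pose S := D *m T *m E.
have SE i j : S i j = t ^+ i * T i j * t ^- j.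
  by rewrite /S mul_mx_diag mxE mul_diag_mx !mxE.
(* The scaled matrix [S] is dissipative for the identity, and [D *m P] intertwines it with [M], so
   the identity is pulled back. *)
exists ((D *m P)^t* *m 1%:M *m (D *m P)); split.
  apply: (lyapunov_pullback (S := S)).
    by rewrite -!mulmxA PM !mulmxA -(mulmxA _ E) ED mulmx1.
  apply: lyapunov1; apply: (@diag_dominant_dissipative _ _ _ e); first exact: ltW.
    move=> i; rewrite SE mulrAC divff ?mul1r ?expf_neq0 ?gt_eqF //.
    rewrite lerNr /e invfM mulrCA mulfV ?mulr1 ?pnatr_eq0 //.
    rewrite -[leRHS]invrK lef_pV2 ?posrE ?invr_gt0 ?oppr_gt0 //.
    rewrite /s (bigD1 i) //= addrCA lerDl addr_ge0 // sumr_ge0 // => j _.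
    by rewrite invr_ge0 oppr_ge0 ltW.
  move=> i j ij; rewrite SE; have [lij|lji] := ltnP i j.
    have /is_trig_mxP -> // := trT; by rewrite mulr0 mul0r normr0 ltW.
  have {}lji : (j < i)%N by rewrite ltn_neqAle eq_sym ij.
  rewrite mulrAC -expfB // normrM (ger0_norm (exprn_ge0 _ (ltW t0))).
  have -> : e = t * K by rewrite /t divfK // gt_eqF.
  rewrite ler_pM ?(exprn_ge0 _ (ltW t0)) //.
    by rewrite -[leRHS]expr1 ler_wiXn2l ?subn_gt0 // ltW.
  rewrite /K (bigD1 i) //= (bigD1 j) //= -[X in 1 + X]addrA [leRHS]addrCA lerDl.
  rewrite addr_ge0 // addr_ge0 // sumr_ge0 // => k _; rewrite sumr_ge0 //.
move=> x; rewrite form_pullback mulmx1 => /cnorm_eq0 Px.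
rewrite -[x]mul1mx -(mulVmx Punit) -[P]mul1mx -ED -!mulmxA.
by rewrite (mulmxA D) Px !mulmx0.
Qed.

(** Strong induction on the size. On ker N, [M] acts as the scalar [b] with zero real part, so the
    identity is a Lyapunov matrix there; the row space of N is invariant and of smaller dimension,
    so the induction hypothesis applies to it. *)
Lemma semistable_lyapunov (C : numClosedFieldType) (n : nat) (M : 'M[C]_n) :
  semistable M -> exists H, lyapunov H M /\ definite H.
Proof.
have [k] := ubnP n; elim: k n M => // k IHk n M nk stM.
have [[b [Mb Reb]]|noim] := pselect (exists b, eigenvalue M b /\ 'Re b = 0); last first.
  apply: hurwitz_lyapunov => b Mb; rewrite lt_def (stM b Mb).1 andbT eq_sym.
  by apply/eqP => Reb; apply: noim; exists b.
set N := M - b%:M; have ker2 := (stM b Mb).2 Reb; rewrite -/N in ker2.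
have NM : M *m N = N *m M by rewrite mulmxBl mulmxBr scalar_mxC.
pose K := eigenspace M b; pose B := row_base N.
have KN : K *m N = 0 by exact: mulmx_ker.
have KM : K *m M = b%:M *m K.
  by apply/eqP; rewrite -subr_eq0 -scalar_mxC -mulmxBr KN.
have [S BM] : exists S, B *m M = S *m B.
  apply/submxP; rewrite eq_row_base.
  have /submxP[D ->] : (B <= N)%MS by rewrite eq_row_base.
  by rewrite -mulmxA -NM mulmxA submxMl.
have rN : (\rank N < k)%N.
  apply: leq_trans (ltnSE nk).
  rewrite -subn_gt0 -mxrank_ker lt0n mxrank_eq0; exact: Mb.
have [H [HS dH]] := IHk _ S rN (semistable_restrict (row_base_free N) BM stM).
exists (K^t* *m 1%:M *m K + B^t* *m H *m B); split.
  apply: lyapunovD; apply: lyapunov_pullback; first exact: KM.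
  - apply: lyapunov1 => x; rewrite mul_mx_scalar -scalemxAl mxE mulrC.
    by rewrite ReMl ?ger0_real ?cnorm_ge0 // Reb mulr0.
  - exact: BM.
  exact: HS.
move=> x; rewrite mulmxDr mulmxDl mxE.
rewrite !form_pullback mulmx1; have [_ Hge _] := HS.
move/eqP; rewrite paddr_eq0 ?cnorm_ge0 // => /andP[/eqP/cnorm_eq0 Kx /eqP/dH Bx].
(* The form vanishes at [x] only if K x = B x = 0. The rows of [K] and [B] span the whole space:
   their dimensions add up to [n], and [ker2] makes ker N meet the image of N trivially. *)
have full : row_full (col_mx K B).
  rewrite /row_full -addsmxE (adds_eqmx (eqmx_refl K) (eq_row_base N)).
  rewrite mxrank_disjoint_sum ?mxrank_ker ?subnK ?rank_leq_col //.
  apply/eqP; rewrite -submx0; apply/rV_subP => v; rewrite sub_capmx.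
  case/andP => /sub_kermxP vN /submxP[w wE].
  by rewrite wE ker2 ?sub0mx // -wE.
by rewrite -[x]mul1mx -(mulVpmx full) -mulmxA mul_col_mx Kx Bx col_mx0 mulmx0.
Qed.

(** * Transfer of stability and of quadratic forms between real and complex matrices *)

Lemma stableE (F : realType) (n : nat) (M : 'M[F]_n) :
  stable M <-> semistable (map_mx (real_complex F) M).
Proof.
split=> [stM b Mb|stM MC b Mb].
  have [Reb ss] := stM b Mb; rewrite -complexRe; split=> [|[Re0]].
    by rewrite lecR.
  by apply/geometric_mup_eqP; have [] := ss Re0.
have [] := stM b Mb; rewrite -complexRe lecR => Reb ss; split=> // Re0.
by split=> //; apply/geometric_mup_eqP; apply: ss; rewrite Re0.
Qed.

Lemma quad_tr (F : comNzRingType) (n : nat) (X : 'M[F]_n) (x y : 'cV[F]_n) :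
  (x^T *m X^T *m y) 0 0 = (y^T *m X *m x) 0 0.
Proof.
have -> : x^T *m X^T *m y = (y^T *m X *m x)^T by rewrite !trmx_mul !trmxK mulmxA.
by rewrite mxE.
Qed.

(** Cauchy-Schwarz in the degenerate case: nonnegativity of the form at x - t X x, for all real t,
    forces |X x|^2 = 0. *)
Lemma possemidef_ker (F : realType) (n : nat) (X : 'M[F]_n) (x : 'cV[F]_n) :
  possemidef X -> (x^T *m X *m x) 0 0 = 0 -> X *m x = 0.
Proof.
move=> [symX psdX] x0; pose y := X *m x; pose s : F := (y^T *m y) 0 0.
pose c : F := (y^T *m X *m y) 0 0; have c0 : 0 <= c by exact: psdX.
have sE : s = \sum_i y i 0 ^+ 2.
  by rewrite /s mxE; apply: eq_bigr => i _; rewrite !mxE expr2.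
have quad t : 0 <= - (2 * t * s) + t ^+ 2 * c.
  have entB (A B : 'M[F]_1) : (A - t *: B) 0 0 = A 0 0 - t * B 0 0 by rewrite !mxE.
  have := psdX (x - t *: y).
  have -> : (x - t *: y)^T = x^T - t *: y^T by apply/rowP => i; rewrite !mxE.
  rewrite mulmxBl -scalemxAl mulmxBl -scalemxAl mulmxBr -scalemxAr entB.
  rewrite entB x0 mulmxBr -scalemxAr entB -/c.
  have -> : (y^T *m X *m x) 0 0 = s by rewrite -mulmxA.
  have -> : (x^T *m X *m y) 0 0 = s by rewrite -{1}symX quad_tr -mulmxA.
  by move=> h; apply: le_trans h _; rewrite le_eqVlt; apply/orP; left; apply/eqP; ring.
have s0 : s = 0.
  apply/eqP; rewrite eq_le; apply/andP; split; last first.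
    by rewrite sE sumr_ge0 // => i _; rewrite sqr_ge0.
  rewrite leNgt; apply/negP => sp.
  (* For t = s / (c + 1) the quadratic equals - t^2 (c + 2), negative if s > 0; the shift by 1
     covers c = 0. *)
  have := quad (s / (c + 1)).
  rewrite (_ : _ + _ = - (s / (c + 1)) * (s / (c + 1)) * (c + 2)).
    rewrite !mulNr oppr_ge0 leNgt; apply/negP/negPn.
    by rewrite mulr_gt0 ?mulr_gt0 ?invr_gt0 ?ltr_wpDl ?ltr0n.
  by field; rewrite gt_eqF ?ltr_wpDl.
rewrite -/y; apply/colP => i; rewrite [RHS]mxE; apply/eqP; rewrite -sqrf_eq0.
by rewrite (psumr_eq0P _ (etrans (esym sE) s0)) // => j _; exact: sqr_ge0.
Qed.

Lemma posdef_unitmx (F : realType) (n : nat) (Q : 'M[F]_n) :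
  posdef Q -> Q \in unitmx.
Proof.
move=> [symQ pdQ]; rewrite -unitmx_tr -row_free_unit; apply/inj_row_free => v vQ.
apply/eqP; rewrite -trmx_eq0; apply: contraTT isT => /pdQ.
by rewrite trmxK -{1}symQ vQ mul0mx mxE ltxx.
Qed.

Lemma posdef_invmx (F : realType) (n : nat) (Q : 'M[F]_n) :
  posdef Q -> posdef (invmx Q).
Proof.
move=> pQ; have Qu := posdef_unitmx pQ; case: pQ => symQ pdQ.
have symI : (invmx Q)^T = invmx Q by rewrite trmx_inv symQ.
split=> // x x0; have := pdQ (invmx Q *m x).
rewrite trmx_mul symI mulmxKV // mulmxA; apply.
by apply: contraNneq x0 => e; rewrite -[x](mulKVmx Qu) e mulmx0.
Qed.

Lemma posdef_possemidef (F : realType) (n : nat) (Q : 'M[F]_n) :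
  posdef Q -> possemidef Q.
Proof.
move=> [symQ pdQ]; split=> // x; have [->|/pdQ/ltW //] := eqVneq x 0.
by rewrite mulmx0 mxE.
Qed.

Local Notation toC := (map_mx (real_complex _)).

(** The two cross terms cancel by symmetry of [S]. Positivity over complex vectors thus reduces to
    positivity over their real and imaginary parts. *)
Lemma hform_real (F : realType) (n : nat) (S : 'M[F]_n) (v : 'rV[F[i]%C]_n) :
  S^T = S ->
  let a := (map_mx (@complex.Re F) v)^T in
  let b := (map_mx (@complex.Im F) v)^T in
  (v *m toC S *m v^t*) 0 0 =
    real_complex F ((a^T *m S *m a) 0 0 + (b^T *m S *m b) 0 0).
Proof.
move=> symS a b.
have vE : v = toC a^T + 'i *: toC b^T.
  by apply/rowP => i; rewrite !mxE [LHS]complexE complexiE.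
clearbody a b; rewrite {}vE.
have -> : (toC a^T + 'i *: toC b^T)^t* = toC a - 'i *: toC b.
  apply/colP => i; rewrite !mxE rmorphD rmorphM /= conjCi mulNr.
  by rewrite !conj_Creal // complex_real.
have cross : b^T *m S *m a = a^T *m S *m b.
  by apply/matrixP => i j; rewrite !ord1 -quad_tr symS.
rewrite !(mulmxDl, mulmxBr) -!(scalemxAl, scalemxAr) -!map_mxM cross.
move: (a^T *m S *m a) (a^T *m S *m b) (b^T *m S *m b) => X Y Z.
by rewrite !mxE mulrA -expr2 sqrCi mulN1r opprD opprK addrA addrK -rmorphD.
Qed.

Lemma toC_trmxC (F : realType) (m n : nat) (X : 'M[F]_(m, n)) :
  (toC X)^t* = toC X^T.
Proof. by apply/matrixP => i j; rewrite !mxE conj_Creal // complex_real. Qed.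

Lemma posdef_hform_gt0 (F : realType) (n : nat) (S : 'M[F]_n)
    (v : 'rV[F[i]%C]_n) :
  posdef S -> v != 0 -> 0 < (v *m toC S *m v^t*) 0 0.
Proof.
move=> pdS v0; have [_ psdS] := posdef_possemidef pdS; case: pdS => symS pdS.
rewrite hform_real // ltcR lt_def addr_ge0 // andbT paddr_eq0 //.
apply: contra v0 => /andP[a0 b0]; apply/eqP/rowP => i; rewrite mxE.
have zero (x : 'cV_n) : (x^T *m S *m x) 0 0 == 0 -> x = 0.
  by apply: contraTeq => x0; have := pdS x x0; rewrite lt_def => /andP[].
move/zero/colP/(_ i): a0; move/zero/colP/(_ i): b0; rewrite !mxE => im0 re0.
by apply/eqP; rewrite eq_complex /= im0 re0 eqxx.
Qed.

Lemma possemidef_hform_ge0 (F : realType) (n : nat) (S : 'M[F]_n)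
    (v : 'rV[F[i]%C]_n) :
  possemidef S -> 0 <= (v *m toC S *m v^t*) 0 0.
Proof. by case=> symS psdS; rewrite hform_real // ler0c addr_ge0. Qed.

Lemma possemidef_hform_ker (F : realType) (n : nat) (S : 'M[F]_n)
    (v : 'rV[F[i]%C]_n) :
  possemidef S -> (v *m toC S *m v^t*) 0 0 = 0 -> v *m toC S = 0.
Proof.
move=> pS; have [symS psdS] := pS.
rewrite hform_real // => /complexI/eqP; rewrite paddr_eq0 // => /andP[].
move=> /eqP/(possemidef_ker pS) a0 /eqP/(possemidef_ker pS) b0.
have vE : v = toC (map_mx (@complex.Re F) v) + 'i *: toC (map_mx (@complex.Im F) v).
  by apply/rowP => i; rewrite !mxE [LHS]complexE complexiE.
rewrite vE mulmxDl -scalemxAl -!map_mxM -symS -[X in X *m S^T]trmxK -trmx_mul a0.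
by rewrite -[X in X *m S^T]trmxK -trmx_mul b0 !trmx0 !map_mx0 scaler0 addr0.
Qed.

(** * Stable matrices are the products (J - R) Q *)

Lemma DH_semistable (F : realType) (n : nat) (J R Q : 'M[F]_n) :
  DHpos J R Q -> semistable (toC ((J - R) *m Q)).
Proof.
move=> [skJ psdR pdQ]; have Qu := posdef_unitmx pdQ.
have pdG := posdef_invmx pdQ; set G := invmx Q in pdG.
set M := toC _; pose JC := toC J; pose RC := toC R; pose GC := toC G.
have ME : M *m GC = JC - RC by rewrite -map_mxM mulmxK // map_mxB.
have JCE : JC^t* = - JC by rewrite toC_trmxC skJ map_mxN.
have GCE : GC^t* = GC by rewrite toC_trmxC pdG.1.
have RCE : RC^t* = RC by rewrite toC_trmxC psdR.1.
have skew (v : 'rV_n) : 'Re ((v *m JC *m v^t*) 0 0) = 0.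
  have : (v *m JC *m v^t*)^t* = - (v *m JC *m v^t*).
    by rewrite !trmxC_mul trmxCK JCE mulNmx mulmxN mulmxA.
  move: (v *m JC *m v^t*) => X /matrixP/(_ 0 0); rewrite !mxE ReE => ->.
  by rewrite subrr mul0r.
have eig b (v : 'rV_n) : v *m M = b *: v ->
    'Re b * (v *m GC *m v^t*) 0 0 = - (v *m RC *m v^t*) 0 0.
  move=> vM; have : v *m (JC - RC) *m v^t* = b *: (v *m GC *m v^t*).
    by rewrite -ME mulmxA vM -!scalemxAl.
  rewrite mulmxBr mulmxBl; have := skew v.
  have := possemidef_hform_ge0 v psdR.
  have := possemidef_hform_ge0 v (posdef_possemidef pdG).
  move: (v *m JC *m _) (v *m RC *m _) (v *m GC *m _) => X Y Z.
  move=> /ger0_real Zr /ger0_real/Creal_ReP Yr X0 /matrixP/(_ 0 0).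
  by rewrite !mxE => /(congr1 (fun z => 'Re z)); rewrite raddfB /= X0 Yr sub0r ReMr.
move=> b /eigenvalueP[v vM v0]; split.
  rewrite -(pmulr_lle0 _ (posdef_hform_gt0 pdG v0)) eig // oppr_le0.
  exact: possemidef_hform_ge0.
(* Here u = w (M - b) satisfies u M = b u. If u is nonzero, then u G u^* > 0, so it suffices to show
   u G u^* = 0. *)
move=> Reb w; move uE : (w *m _) => u wNN.
have uM : u *m M = b *: u.
  by apply/eqP; rewrite -subr_eq0 -mul_mx_scalar -mulmxBr wNN.
apply: contraTeq isT => u0; have := posdef_hform_gt0 pdG u0.
rewrite lt_def => /andP[/negP[]]; apply/eqP.
have uR : u *m RC = 0.
  apply: possemidef_hform_ker psdR _; apply/eqP.
  by rewrite -oppr_eq0 -(eig b) // Reb mul0r.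
have uJ : u *m JC = b *: (u *m GC).
  by rewrite scalemxAl -uM -mulmxA ME mulmxBr uR subr0.
have Ru : RC *m u^t* = 0.
  by rewrite -RCE -trmxC_mul uR trmx0 map_mx0.
have bJ : b^* = - b.
  move/eqP: Reb; rewrite ReE mulf_eq0 invr_eq0 pnatr_eq0 orbF addrC addr_eq0.
  by move/eqP.
(* Since [b] is purely imaginary and J skew, the adjoint of u J = b u G has the same factor [b]. *)
have Ju : JC *m u^t* = b *: (GC *m u^t*).
  rewrite -[JC]opprK -JCE mulNmx -trmxC_mul uJ linearZ /= map_mxZ trmxC_mul GCE.
  by rewrite /= bJ scaleNr opprK.
(* Multiplied on the right by G u^*, the left side becomes w J u^* = b w G u^*, which cancels the
   first term on the right and leaves u G u^* = 0. *)
have : w *m M = b *: w + u by rewrite -uE mulmxBr mul_mx_scalar addrCA subrr addr0.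
move/(congr1 (fun X => X *m GC *m u^t*)).
rewrite /= -(mulmxA w M) ME -(mulmxA w) -(mulmxA _ GC) mulmxBl Ru subr0 Ju.
rewrite mulmxDl -scalemxAl -scalemxAr -[LHS]addr0 => /addrI/esym uGu.
by rewrite -mulmxA uGu mxE.
Qed.

Lemma stable_DHP (F : realType) (n : nat) (M : 'M[F]_n) :
  stable M <-> exists J R Q, DHpos J R Q /\ M = (J - R) *m Q.
Proof.
rewrite stableE; split=> [stM|[J [R [Q [DH ->]]]]]; last exact: DH_semistable.
have [H [[HH Hge Hle] dH]] := semistable_lyapunov stM.
pose Q := map_mx (@complex.Re F) H.
(* At a real vector, the real part of the form depends only on the real part of the matrix; this
   lets Re H inherit both Lyapunov inequalities. *)
have ReM (x : 'cV[F]_n) (Z : 'M[F[i]%C]_n) :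
    complex.Re (((toC x)^t* *m Z *m toC x) 0 0) =
    (x^T *m map_mx (@complex.Re F) Z *m x) 0 0.
  rewrite toC_trmxC !mxE raddf_sum; apply: eq_bigr => i _.
  rewrite !mxE [in RHS]mulr_suml mulr_suml raddf_sum; apply: eq_bigr => j _.
  by rewrite !mxE /=; case: (Z _ _) => re im /=; ring.
have ReHM : map_mx (@complex.Re F) (H *m toC M) = Q *m M.
  apply/matrixP => i j; rewrite !mxE raddf_sum; apply: eq_bigr => k _.
  by rewrite !mxE; case: (H _ _) => re im /=; ring.
have pdQ : posdef Q.
  split=> [|x x0].
    apply/matrixP => i j; rewrite !mxE -[in LHS]HH !mxE.
    by case: (H i j).
  rewrite -ReM.
  have : 0 < ((toC x)^t* *m H *m toC x) 0 0.
    rewrite lt_def Hge andbT; apply: contra x0 => /eqP/dH/colP x0.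
    by apply/eqP/colP => i; have := x0 i; rewrite !mxE => /complexI.
  by rewrite ltcE => /andP[].
have Qu := posdef_unitmx pdQ; have [symQ _] := pdQ.
have QM (x : 'cV[F]_n) : (x^T *m (Q *m M) *m x) 0 0 <= 0.
  by rewrite -ReHM -ReM -lecR complexRe mulmxA.
pose N := M *m invmx Q.
exists (2^-1 *: (N - N^T)), (- (2^-1 *: (N + N^T))), Q; split; last first.
  rewrite opprK -scalerDr addrACA addNr addr0 -mulr2n -scaler_nat scalerA.
  by rewrite mulVf ?pnatr_eq0 // scale1r mulmxKV.
split=> //; first by rewrite linearZ linearB /= trmxK -scalerN opprB.
split=> [|x]; first by rewrite linearN linearZ linearD /= trmxK addrC.
have -> : (x^T *m (- (2^-1 *: (N + N^T))) *m x) 0 0 = - (x^T *m N *m x) 0 0.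
  rewrite mulmxN -scalemxAr mulmxDr mulNmx -scalemxAl mulmxDl.
  move: (quad_tr N x x); move: (x^T *m N *m x) (x^T *m N^T *m x) => X Y YX.
  by rewrite !mxE YX; field.
(* With y = Q^-1 x, the Lyapunov form y^T Q M y is x^T M Q^-1 x = x^T N x. *)
rewrite oppr_ge0; have := QM (invmx Q *m x).
by rewrite trmx_mul trmx_inv symQ -!mulmxA mulKmx // !mulmxA.
Qed.

(** * Solvability of B K C = A - (J - R) Q and the set of gains *)

(** Compatibility says that B B^+ on the left and C^+ C on the right both fix A - (J - R) Q, where
    ^+ is the pseudoinverse. *)
Lemma DH_compatible_gainE (F : realType) (n m p : nat)
    (A : 'M[F]_n) (B : 'M[F]_(n, m)) (C : 'M[F]_(p, n)) (J R Q : 'M[F]_n) :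
  DH_compatible A B C J R Q ->
  B *m DH_gain A B C J R Q *m C = A - (J - R) *m Q.
Proof.
case; rewrite mulmxBl mul1mx => /eqP; rewrite subr_eq0 => /eqP BB.
rewrite mulmxBr mulmx1 => /eqP; rewrite subr_eq0 => /eqP CC.
by rewrite /DH_gain !mulmxA -BB -mulmxA CC.
Qed.

Lemma DH_compatible_feedback (F : realType) (n m p : nat)
    (A : 'M[F]_n) (B : 'M[F]_(n, m)) (C : 'M[F]_(p, n)) (J R Q : 'M[F]_n)
    (K : 'M[F]_(m, p)) :
  A - B *m K *m C = (J - R) *m Q -> DH_compatible A B C J R Q.
Proof.
move=> E; have [BB _ _ _] := mppinvP B; have [CC _ _ _] := mppinvP C.
rewrite /DH_compatible; have -> : A - (J - R) *m Q = B *m K *m C.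
  by rewrite -E opprB addrC subrK.
split; first by rewrite mulmxBl mul1mx !mulmxA BB subrr.
by rewrite mulmxBr mulmx1 -!mulmxA [C *m _]mulmxA CC subrr.
Qed.

Theorem theorem6 (F : realType) (n m p : nat)
  (A : 'M[F]_n) (B : 'M[F]_(n, m)) (C : 'M[F]_(p, n)) :
  (stabilizable A B C <->
     exists J R Q : 'M[F]_n, DHpos J R Q /\ DH_compatible A B C J R Q) /\
  (forall J R Q : 'M[F]_n, DHpos J R Q -> DH_compatible A B C J R Q ->
     DH_stabilizing_gains A B C J R Q =
     [set K : 'M[F]_(m, p) | exists Y Z : 'M[F]_(m, p),
        K = DH_gain A B C J R Q + (1%:M - mppinv B *m B) *m Y
            + Z *m (1%:M - C *m mppinv C)]).
Proof.
(* The closed-loop matrix depends on [K] only through B K C, so it equals (J - R) Q as soon as this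
   product agrees with that of the gain f. *)
have stab J R Q K : DHpos J R Q -> DH_compatible A B C J R Q ->
    B *m K *m C = B *m DH_gain A B C J R Q *m C -> stabilizing_gains A B C K.
  move=> DH DHc E; apply/stable_DHP; exists J, R, Q; split=> //.
  by rewrite E DH_compatible_gainE // opprB addrC subrK.
split.
  split=> [[K /stable_DHP[J [R [Q [DH E]]]]]|[J [R [Q [DH DHc]]]]].
    by exists J, R, Q; split=> //; exact: DH_compatible_feedback E.
  by exists (DH_gain A B C J R Q); exact: stab DH DHc _.
move=> J R Q DH DHc; have [BB _ _ _] := mppinvP B; have [CC _ _ _] := mppinvP C.
set f := DH_gain A B C J R Q; apply/seteqP; split=> K /=.
  (* The witnesses come from Z - B^+ B Z C C^+ = (I - B^+ B) Z + B^+ B Z (I - C C^+). *)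
  case=> _ [Z ->]; exists Z, (mppinv B *m B *m Z).
  rewrite mulmxBl mulmxBr mul1mx mulmx1 !addrA subrK; congr (_ - _).
  by rewrite mulmxA.
have B1 : B *m (1%:M - mppinv B *m B) = 0.
  by rewrite mulmxBr mulmx1 mulmxA BB subrr.
have C1 : (1%:M - C *m mppinv C) *m C = 0.
  by rewrite mulmxBl mul1mx CC subrr.
case=> Y [Z ->]; split.
  apply: (stab _ _ _ _ DH DHc); rewrite -/f 2!mulmxDr 2!mulmxDl.
  rewrite (mulmxA B _ Y) B1 !mul0mx addr0.
  by rewrite -(mulmxA B (Z *m _)) -(mulmxA Z) C1 !mulmx0 addr0.
(* With K - f itself as parameter, the correction term vanishes: [B] kills the first summand from
   the left and [C] the second from the right. *)
exists ((1%:M - mppinv B *m B) *m Y + Z *m (1%:M - C *m mppinv C)).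
rewrite [mppinv B *m B *m _]mulmxDr -(mulmxA (mppinv B) B ((_ - _) *m Y)).
rewrite (mulmxA B _ Y) B1 mul0mx mulmx0 add0r -(mulmxA _ _ C) -(mulmxA Z) C1.
by rewrite !mulmx0 mul0mx subr0 addrA.
Qed.
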